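(* For every $\epsilon>0$, there exists a smooth and strictly positive probability density $p_\epsilon$ on $\mathbb{R}$ such that, if $\mathcal{P}$ is the additive noise channel with this density, then $(1-\epsilon)F_{\mathcal{P}}\le F_{\mathrm{sgn}(\mathcal{P})}\le F_{\mathcal{P}}$. Moreover, the $p_\epsilon$ may be chosen to converge pointwise to another positive (but not smooth) probability density: $p_\epsilon(y)\to p_0(y)=\frac12\exp(-|y|)$ as $\epsilon\to0$, for every $y\in\mathbb{R}$.
   Context: The additive noise channel with density $p$ is $\mathcal{P}=(\mathcal{P}_x)_{x\in\mathbb{R}}$, where $\mathcal{P}_x$ is the law of $x+z$ with $z$ having density $p$ with respect to Lebesgue measure. The quantized channel $\mathrm{sgn}(\mathcal{P})$ has range $\{-1,1\}$: a sample from $\mathrm{sgn}(\mathcal{P})_x$ is $\mathrm{sgn}(y)$ for $y\sim\mathcal{P}_x$ (the value $0$ may be mapped arbitrarily). For a channel $\mathcal{P}'=(\mathcal{P}'_x)$ with $\mathcal{P}'_x\ll\mathcal{P}'_0$ and $d\mathcal{P}'_x/d\mathcal{P}'_0\in L^2(\mathcal{P}'_0)$, the channel overlap is $R_{\mathcal{P}'}(x^{(1)},x^{(2)})=\mathbb{E}_{y\sim\mathcal{P}'_0}\left[\left(\frac{d\mathcal{P}'_{x^{(1)}}}{d\mathcal{P}'_0}(y)-1\right)\left(\frac{d\mathcal{P}'_{x^{(2)}}}{d\mathcal{P}'_0}(y)-1\right)\right]$, and the Fisher information is $F_{\mathcal{P}'}=\frac{\partial^2R_{\mathcal{P}'}}{\partial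 x^{(1)}\partial x^{(2)}}(0,0)$. *)

(* Defs.v *)
From HB Require Import structures.
From mathcomp Require Import all_boot all_order all_algebra.
From mathcomp Require Import all_classical all_reals all_analysis.
From mathcomp Require Import measurable_realfun.
Import Order.TTheory GRing.Theory Num.Theory.
Import numFieldNormedType.Exports.

Set Implicit Arguments.
Unset Strict Implicit.
Unset Printing Implicit Defensive.

Local Open Scope classical_set_scope.
Local Open Scope ring_scope.
Local Open Scope charge_scope.

Record density (R : realType) := Density {
  density_fun :> R -> R ;
  density_measurable : measurable_fun [set: R] density_fun ;
  density_ge0 : forall y, 0 <= density_fun y ;
  density_int1 : (\int[lebesgue_measure]_y (density_fun y)%:E = 1)%E
}.

Definition density_prob (R : realType) (p : density R) :
    set (measurableTypeR R) -> \bar R :=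
  fun A => (\int[lebesgue_measure]_(y in A) (p y)%:E)%E.

Section density_prob_probability.
Variables (R : realType) (p : density R).

Let density_prob0 : density_prob p set0 = 0%E.
Proof. by rewrite /density_prob integral_set0. Qed.

Let density_prob_ge0 A : (0 <= density_prob p A)%E.
Proof. by apply: integral_ge0 => y _; rewrite lee_fin density_ge0. Qed.

Let density_prob_sigma_additive : semi_sigma_additive (density_prob p).
Proof.
move=> /= A mA tA mUA; rewrite /density_prob ge0_integral_bigcup//=.
- apply: is_cvg_ereal_nneg_natsum_cond => n _ _.
  by apply: integral_ge0 => y _; rewrite lee_fin density_ge0.
- by apply/measurable_EFinP/measurable_funTS; exact: density_measurable.
- by move=> y _; rewrite lee_fin density_ge0.
Qed.

HB.instance Definition _ := isMeasure.Build _ _ _ (density_prob p)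
  density_prob0 density_prob_ge0 density_prob_sigma_additive.

Let density_prob_setT : density_prob p [set: _] = 1%E.
Proof. exact: density_int1. Qed.

HB.instance Definition _ :=
  @Measure_isProbability.Build _ _ R (density_prob p) density_prob_setT.

End density_prob_probability.

(* Only the measurability of each output law is recorded: no joint
   measurability in the input is required. *)
Definition channel (R : realType) (d : measure_display) (T : measurableType d)
  := R -> probability T R.

Definition translate (R : realType) (x : R) :
  measurableTypeR R -> measurableTypeR R := fun z => x + z.

Lemma measurable_translate (R : realType) (x : R) :
  measurable_fun [set: measurableTypeR R] (translate x).
Proof. by apply: measurable_funD; [exact: measurable_cst|exact: measurable_id]. Qed.

HB.instance Definition _ (R : realType) (x : R) :=
  @isMeasurableFun.Build _ _ (measurableTypeR R) (measurableTypeR R)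
    (translate x) (measurable_translate x).

Definition additive_channel (R : realType) (p : density R) :
    channel R (measurableTypeR R) :=
  fun x => distribution (density_prob p) (translate x).

(* The boolean [b] fixes the value (-1) ^+ b taken at 0. *)
Definition sign_at0 (R : realType) (b : bool) :
    measurableTypeR R -> measurableTypeR R :=
  fun y => if y == 0 :> R then (-1) ^+ b else Num.sg (y : R).

Lemma measurable_sign_at0 (R : realType) (b : bool) :
  measurable_fun [set: measurableTypeR R] (@sign_at0 R b).
Proof.
rewrite [X in measurable_fun _ X](_ : _ = fun y : measurableTypeR R =>
    if (y : R) == 0 then (-1) ^+ b else if (y : R) < 0 then -1 else 1).
  apply: measurable_fun_ifT => //=.
    exact: measurable_fun_eqr.
  apply: measurable_fun_ifT => //=.
  exact: measurable_fun_ltr.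
apply/funext => y; rewrite /sign_at0.
by have [//|y0] := eqVneq (y : R) 0; rewrite /Num.sg (negbTE y0).
Qed.

HB.instance Definition _ (R : realType) (b : bool) :=
  @isMeasurableFun.Build _ _ (measurableTypeR R) (measurableTypeR R)
    (@sign_at0 R b) (@measurable_sign_at0 R b).

Definition sgn_channel (R : realType) (b : bool)
    (P : channel R (measurableTypeR R)) : channel R (measurableTypeR R) :=
  fun x => distribution (P x) (@sign_at0 R b).

Section overlap.
Context (R : realType) (d : measure_display) (T : measurableType d).
Variable P : channel R T.

Definition likelihood_ratio (x : R) : T -> R :=
  fun y => fine ('d (charge_of_finite_measure (P x)) '/d (P 0) y).

(* The library's Radon-Nikodym derivative takes a default value in the absence
   of absolute continuity, hence the explicit first conjunct. *)
Definition overlap_defined :=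
  forall x : R, P x `<< P 0 /\ likelihood_ratio x \in Lfun (P 0) 2%:E.

Definition overlap (x1 x2 : R) : R :=
  fine 'E_(P 0)[fun y => (likelihood_ratio x1 y - 1) *
                         (likelihood_ratio x2 y - 1)].

(* [derive1] is total: [fisher_defined] states that the iterated partial
   derivative in [fisher] exists. *)
Definition fisher_defined :=
  [/\ overlap_defined,
      \forall x1 \near (0 : R), derivable (overlap x1) 0 1 &
      derivable (fun x1 : R => derive1 (overlap x1) 0) 0 1].

Definition fisher : R := derive1 (fun x1 : R => derive1 (overlap x1) 0) 0.

End overlap.

Definition smooth (R : realType) (f : R -> R) :=
  forall (n : nat) (y : R), derivable (derive1n n f) y 1.

(* Main.v *)
Require Import Defs.
From mathcomp Require Import all_boot all_order all_algebra.
From mathcomp Require Import all_classical all_reals all_analysis.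
From mathcomp Require Import ring lra measurable_realfun.
Import Order.TTheory GRing.Theory Num.Theory.
Import numFieldNormedType.Exports.

(** Smooth the Laplace density [exp (- |y|) / 2] into the hyperbolic density
    [p y = c * exp (- sqrt (y ^ 2 + d ^ 2))] with a small [d <> 0]. Its score
    [k = p' / p = - y / sqrt (y ^ 2 + d ^ 2)] stays in [[-1, 1]] and is close to
    [- sgn y] away from the origin. Observing only the sign of the output
    therefore loses almost nothing of the score, which is what carries the
    Fisher information.

    Boundedness of the score settles all the analysis. It makes [ln p]
    1-Lipschitz, hence [p (y - x) <= exp |x| * p y] ([density_harnack]), so the
    likelihood ratios are bounded and the means [x |-> E[h (x + z)]] of bounded
    [h] can be differentiated under the integral sign
    ([is_derive_noisy_mean]). Both overlaps are expressed through such means.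
    For the additive channel [R(x1, x2) = E_{x2}[r - 1] - E_0[r - 1]], where
    [r y = p (y - x1) / p y], and differentiating twice gives
    [F = E_0[k ^ 2]]. For the quantized channel, if the sign [s] has mean [0]
    under [p], then the likelihood ratio at a sign [v] is [1 + v * G x] where
    [G x = E_x[s]], so that [R(x1, x2) = G x1 * G x2] and
    [F_sgn = (G' 0) ^ 2 = E_0[s * k] ^ 2].

    The upper bound [F_sgn <= F] is the Cauchy-Schwarz inequality. For the
    lower bound, [F <= 1] because [|k| <= 1], while [s * k = - |k|] and
    [E_0[|k|] = 2 * p 0] by the fundamental theorem of calculus on each half
    line. As the mass of [exp (- sqrt (y ^ 2 + d ^ 2))] is at most [2], this
    gives [F_sgn = (2 * p 0) ^ 2 >= exp (- 2 * d) >= 1 - 2 * d], and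
    [d = eps / 2] is a suitable choice. The same family at [d = 0] is the
    Laplace density, to which it converges. *)

Set Implicit Arguments.
Unset Strict Implicit.
Unset Printing Implicit Defensive.

Local Open Scope classical_set_scope.
Local Open Scope ring_scope.

(** * Overlap of a channel with bounded likelihood ratios *)

Section bounded_likelihood.
Context (R : realType) (d : measure_display) (T : measurableType d).

Lemma bounded_integrable (P : probability T R) (h : T -> R) (C : R) :
  measurable_fun [set: T] h -> (forall y, `|h y| <= C) ->
  P.-integrable [set: T] (EFin \o h).
Proof.
move=> mh hC; apply: measurable_bounded_integrable => //.
  exact: (le_lt_trans (probability_le1 P measurableT) (ltry 1)).
exists C; split; first exact: num_real.
by move=> M CM y _ /=; rewrite (le_trans (hC y))// ltW.
Qed.

Lemma bounded_Lfun2 (P : probability T R) (h g : T -> R) (C : R) :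
  measurable_fun [set: T] h -> measurable_fun [set: T] g ->
  (forall y, `|h y| <= C) -> ae_eq P [set: T] g h -> g \in Lfun P 2%:E.
Proof.
move=> mh mg hC gh; rewrite inE; apply/andP; split; rewrite inE//=.
rewrite /finite_norm unlock poweR_lty//.
have m2 (f : T -> R) : measurable_fun [set: T] f ->
    measurable_fun [set: T] (fun x => (`|f x| `^ 2)%:E).
  move=> mf; apply/measurable_EFinP.
  by apply: (measurableT_comp (measurable_powR _)); exact: measurableT_comp.
under eq_integral do rewrite poweR_EFin/=.
rewrite (@ge0_ae_eq_integral _ _ _ P _ _ (fun x => (`|h x| `^ 2)%:E))//.
- apply: (@le_lt_trans _ _ (\int[P]_x (C ^+ 2)%:E)%E).
    apply: ge0_le_integral => //; first exact: m2.
    move=> x _; rewrite lee_fin powR_mulrn//.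
    by rewrite lerXn2r// nnegrE (le_trans _ (hC x)).
  rewrite integral_cst//=.
  by rewrite probability_setT mule1 ltry.
- exact: m2.
- exact: m2.
- exact: (ae_eq_comp (fun z => (`|z| `^ 2)%:E) gh).
Qed.

Variables (P : channel R T) (r : R -> T -> R).
Hypothesis mr : forall x, measurable_fun [set: T] (r x).
Hypothesis br : forall x, exists C : R, forall y, `|r x y| <= C.
Hypothesis Pr : forall x A, measurable A ->
  P x A = (\int[P 0%R]_(y in A) (r x y)%:E)%E.

Lemma channel_dominated x : P x `<< P 0.
Proof.
apply/null_content_dominatesP => A mA PA0.
by rewrite Pr//; apply: null_set_integral => //; exact/measurable_EFinP/measurable_funTS.
Qed.

Lemma likelihood_ratio_measurable x :
  measurable_fun [set: T] (likelihood_ratio P x).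
Proof.
have dP := channel_dominated x.
exact: measurableT_comp.
Qed.

(** The Radon-Nikodym derivative is only determined almost everywhere, which
    suffices because the overlap is an integral. *)
Lemma likelihood_ratio_ae x : ae_eq (P 0) [set: T] (likelihood_ratio P x) (r x).
Proof.
have dP := channel_dominated x.
have : ae_eq (P 0) [set: T] (Radon_Nikodym (charge_of_finite_measure (P x)) (P 0))
    (EFin \o r x).
  apply: integral_ae_eq => //.
  - exact: Radon_Nikodym_integrable.
  - exact/measurable_EFinP.
  - by move=> E _ mE; rewrite -Radon_Nikodym_integral//= Pr.
exact: (ae_eq_comp fine).
Qed.

Lemma bounded_overlap_defined : overlap_defined P.
Proof.
move=> x; split; first exact: channel_dominated.
have [C rC] := br x.
apply: (bounded_Lfun2 (mr x) _ rC) => //; first exact: likelihood_ratio_measurable.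
exact: likelihood_ratio_ae.
Qed.

Lemma overlapE x1 x2 :
  overlap P x1 x2 = \int[P 0]_y ((r x1 y - 1) * (r x2 y - 1)).
Proof.
rewrite /overlap unlock; congr fine.
apply: ae_eq_integral => //.
- by apply/measurable_EFinP/measurable_funM; apply: measurable_funB => //;
    exact: likelihood_ratio_measurable.
- by apply/measurable_EFinP/measurable_funM; apply: measurable_funB.
- apply: (@ae_eq_trans _ _ _ _ _ _ _
    (fun y => ((r x1 y - 1) * (likelihood_ratio P x2 y - 1))%:E)).
    exact: (ae_eq_comp2 (fun y z => ((z - 1) * (likelihood_ratio P x2 y - 1))%:E)
      (likelihood_ratio_ae x1)).
  exact: (ae_eq_comp2 (fun y z => ((r x1 y - 1) * (z - 1))%:E)
    (likelihood_ratio_ae x2)).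
Qed.

End bounded_likelihood.

(** * Output laws of the additive channel *)

Section translation.
Context (R : realType).
Notation mu := (@lebesgue_measure R).

(** A measure agreeing with Lebesgue measure on the intervals `]a, b]` is
    Lebesgue measure. *)
Lemma lebesgue_measure_translate (x : R) (A : set (measurableTypeR R)) :
  measurable A -> pushforward mu (translate x) A = mu A.
Proof.
move=> mA; apply/esym.
apply: (lebesgue_measure_unique (mu := pushforward mu (translate x))) => //.
move=> _ [[a b] _ <-] /=; rewrite /pushforward.
rewrite (_ : translate x @^-1` _ = [set` `](a - x), (b - x)]]); last first.
  apply/seteqP; split => z; rewrite /translate/= !in_itv/=.
    by rewrite ltrBlDl lerBrDl.
  by rewrite ltrBlDl lerBrDl.
rewrite !lebesgue_measure_itv /= !lte_fin ltrD2r; case: ifP => // _.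
by rewrite -!EFinB; congr EFin; ring.
Qed.

Lemma ge0_integral_translate (x : R) (f : R -> \bar R) (A : set R) :
  measurable A -> measurable_fun [set: R] f -> (forall y, 0 <= f y)%E ->
  (\int[mu]_(y in translate x @^-1` A) f (x + y)%R = \int[mu]_(y in A) f y)%E.
Proof.
move=> mA mf f0.
rewrite -(@ge0_integral_pushforward _ _ _ _ _ _ (measurable_translate x) mu A f)//.
- by apply: eq_measure_integral => B mB _; exact: lebesgue_measure_translate.
- exact: measurable_funTS.
Qed.

End translation.

Section density_prob_theory.
Context (R : realType).
Notation mu := (@lebesgue_measure R).
Implicit Types p : density R.

Lemma density_integrable p : mu.-integrable [set: R] (EFin \o p).
Proof.
apply/integrableP; split.
  by apply/measurable_EFinP; exact: density_measurable.
under eq_integral => y _ do rewrite /= ger0_norm ?density_ge0//.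
by rewrite density_int1 ltry.
Qed.

Lemma mul_density_integrable p (h : R -> R) (C : R) (A : set R) : measurable A ->
  measurable_fun [set: R] h -> (forall y, `|h y| <= C) ->
  mu.-integrable A (EFin \o (fun y => h y * p y)).
Proof.
move=> mA mh hC; apply: (integrableS measurableT) => //.
have := integrableZl measurableT C (density_integrable p).
apply: le_integrable => //.
- by apply/measurable_EFinP; apply: measurable_funM => //; exact: density_measurable.
- move=> y _ /=; rewrite lee_fin !normrM ler_wpM2r//.
  by rewrite (le_trans (hC y))// ler_norm.
Qed.

Lemma density_prob_dominated p : density_prob p `<< mu.
Proof.
apply/null_content_dominatesP => A mA A0.
by apply: null_set_integral => //; apply/measurable_EFinP;
  apply: measurable_funTS; exact: density_measurable.
Qed.

Lemma Radon_Nikodym_density_prob p : ae_eq mu [set: R]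
  (Radon_Nikodym (charge_of_finite_measure (density_prob p)) mu) (EFin \o p).
Proof.
have dp := density_prob_dominated p.
apply: integral_ae_eq => //.
- exact: Radon_Nikodym_integrable.
- by apply/measurable_EFinP; exact: density_measurable.
- by move=> E _ mE; rewrite -Radon_Nikodym_integral.
Qed.

(** The measure [density_prob p] is given by its values on sets; integrals
    against it are reached through its Radon-Nikodym derivative, which is [p]. *)
Lemma integral_density_prob p (h : R -> R) (C : R) (A : set R) : measurable A ->
  measurable_fun [set: R] h -> (forall y, `|h y| <= C) ->
  (\int[density_prob p]_(y in A) (h y)%:E = \int[mu]_(y in A) (h y * p y)%:E)%E.
Proof.
move=> mA mh hC; have dp := density_prob_dominated p.
rewrite -(Radon_Nikodym_change_of_variables dp)//=; last first.
  apply: (integrableS measurableT) => //.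
  by apply: bounded_integrable; [exact: mh|exact: hC].
apply: ae_eq_integral => //.
- apply: emeasurable_funM; first exact/measurable_EFinP/measurable_funTS.
  by apply: measurable_funTS; apply: measurable_int; exact: Radon_Nikodym_integrable.
- apply/measurable_EFinP/measurable_funTS/measurable_funM => //.
  exact: density_measurable.
- apply: (ae_eq_subset (A := setT)) => //.
  under [X in ae_eq _ _ _ X]eq_fun do rewrite EFinM.
  exact: (ae_eqe_mul2l _ (Radon_Nikodym_density_prob p)).
Qed.

Section translated.
Variables (p : density R) (x : R).

Definition translated_fun (y : R) := p (y - x).

Lemma translated_measurable : measurable_fun [set: R] translated_fun.
Proof.
apply: measurableT_comp; first exact: density_measurable.
by apply: measurable_funB.
Qed.

Lemma translated_int1 : (\int[mu]_y (translated_fun y)%:E = 1)%E.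
Proof.
rewrite -(ge0_integral_translate x)//; last 2 first.
- by apply/measurable_EFinP; exact: translated_measurable.
- by move=> y; rewrite lee_fin density_ge0.
rewrite -(density_int1 p); apply: eq_integral => y _.
by rewrite /translated_fun addrC addKr.
Qed.

Definition translated : density R :=
  Density translated_measurable (fun y => density_ge0 p (y - x)) translated_int1.

(** The output law at input [x] has density [y |-> p (y - x)]. *)
Lemma additive_channelE (A : set (measurableTypeR R)) : measurable A ->
  additive_channel p x A = density_prob translated A.
Proof.
move=> mA; rewrite /density_prob -(ge0_integral_translate x)//; last 2 first.
- by apply/measurable_EFinP; exact: translated_measurable.
- by move=> y; rewrite lee_fin density_ge0.
apply: eq_integral => y _.
by rewrite /= /translated_fun addrC addKr.
Qed.

Lemma integral_additive_channel (h : R -> R) (C : R) (A : set R) : measurable A ->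
  measurable_fun [set: R] h -> (forall y, `|h y| <= C) ->
  (\int[additive_channel p x]_(y in A) (h y)%:E =
   \int[mu]_(y in A) (h y * p (y - x))%:E)%E.
Proof.
move=> mA mh hC; rewrite -(integral_density_prob translated mA mh hC).
by apply: eq_measure_integral => B mB _; exact: additive_channelE.
Qed.

End translated.
End density_prob_theory.

(** * Differentiating the mean of a bounded function of the output *)

Section score.
Context (R : realType).
Notation mu := (@lebesgue_measure R).
Variables (p : density R) (k : R -> R).
Hypothesis p_gt0 : forall y, 0 < p y.
Hypothesis derive_p : forall y : R, is_derive y 1 (p : R -> R) (k y * p y).
Hypothesis k_le1 : forall y, `|k y| <= 1.
Hypothesis mk : measurable_fun [set: R] k.

Let p_neq0 y : p y != 0. Proof. exact: lt0r_neq0. Qed.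

(** The mean value theorem, the derivative of [ln p] being the score [k]. *)
Lemma ln_density_lipschitz a b : `|ln (p b) - ln (p a)| <= `|b - a|.
Proof.
wlog ab : a b / a < b.
  move=> W; case: (ltgtP a b) => [||->]; first exact: W.
    by move=> ba; rewrite distrC (distrC b); exact: W.
  by rewrite !subrr.
have dln (y : R) : is_derive y 1 (@ln R \o p) (k y).
  rewrite [k y](_ : _ = (k y * p y) *: (p y)^-1); last first.
    by rewrite /GRing.scale/= mulfK.
  have := is_derive1_comp (is_derive1_ln (p_gt0 y)) (derive_p y).
  by rewrite mulrC.
have cf : {within `[a, b], continuous (@ln R \o p)}.
  by apply: derivable_within_continuous => y _; have [] := dln y.
have [c _ /= ->] := @MVT _ (@ln R \o p) k a b ab (fun y _ => dln y) cf.
by rewrite normrM ler_piMl.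
Qed.

Lemma density_harnack x y : p (y - x) <= expR `|x| * p y.
Proof.
have := ln_density_lipschitz y (y - x).
rewrite addrAC subrr sub0r normrN => /(le_trans (ler_norm _)).
rewrite -(ler_expR (_ - _)) expRB !lnK ?posrE//.
by rewrite ler_pdivrMr.
Qed.

(** The mean of [h] over the output of the additive channel at input [x]. *)
Definition noisy_mean (h : R -> R) (x : R) := \int[mu]_y (h y * p (y - x)).

Section bounded.
Variables (h : R -> R) (C : R).
Hypothesis mh : measurable_fun [set: R] h.
Hypothesis hC : forall y, `|h y| <= C.

Lemma noisy_integrable x : mu.-integrable [set: R] (EFin \o (fun y => h y * p (y - x))).
Proof. exact: (mul_density_integrable (translated p x) measurableT mh hC). Qed.

Lemma integral_noisy x :
  (\int[additive_channel p x]_y (h y)%:E = (noisy_mean h x)%:E)%E.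
Proof.
rewrite (integral_additive_channel p x measurableT mh hC) /noisy_mean fineK//.
exact: (integrable_fin_num measurableT (noisy_integrable x)).
Qed.

(** Differentiation under the integral sign: for inputs [t] at distance less
    than [1] of [x], the integrand has derivative [- h y * k (y - t) * p (y - t)],
    which [density_harnack] dominates by a multiple of [p y] independent of [t]. *)
Lemma is_derive_noisy_mean (x : R) : is_derive x 1 (noisy_mean h)
  (- noisy_mean (fun y => h y * k (y - x)) x).
Proof.
pose f (t y : R) := h y * p (y - t).
have df (t y : R) : is_derive t 1 (f ^~ y) (- (h y * k (y - t) * p (y - t))).
  have ds : is_derive t (1 : R) (fun t => y - t) (-1).
    by apply: is_derive_eq; rewrite add0r mul1r.
  have := is_deriveZ (h y) (is_derive1_comp (g := fun t => y - t) (derive_p (y - t)) ds).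
  by congr is_derive; rewrite /GRing.scale/=; ring.
have C0 : 0 <= C by exact: le_trans (hC 0).
have Ia : `]x - 1, x + 1[%classic x.
  by rewrite /= in_itv/= ltrBlDr !ltrDl ltr01.
have If t : `]x - 1, x + 1[%classic t -> mu.-integrable [set: R] (EFin \o f t).
  by move=> _; exact: noisy_integrable.
have Df t (y : measurableTypeR R) : `]x - 1, x + 1[%classic t -> [set: R] y ->
    derivable (f ^~ y) t 1 by move=> _ _; have [] := df t y.
pose E := C * expR (`|x| + 1).
have G0 (y : measurableTypeR R) : 0 <= E * p y.
  by rewrite !mulr_ge0 ?expR_ge0 ?density_ge0.
have IG : mu.-integrable [set: R] (EFin \o (fun y : measurableTypeR R => E * p y)).
  exact: (integrableZl measurableT E (density_integrable p)).
have fG t (y : measurableTypeR R) : `]x - 1, x + 1[%classic t -> [set: R] y ->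
    `|partial1of2 f t y| <= E * p y.
  rewrite /= in_itv/= => /andP[xt tx] _.
  rewrite partial1of2E; have [_ ->] := df t y.
  rewrite normrN !normrM (ger0_norm (density_ge0 _ _)) -mulrA.
  rewrite -(mulrA C) ler_pM ?mulr_ge0 ?density_ge0//.
  apply: (@le_trans _ _ (1 * p (y - t))); first by rewrite ler_wpM2r ?density_ge0.
  rewrite mul1r (le_trans (density_harnack t y))// ler_wpM2r ?density_ge0//.
  rewrite ler_expR -[in leLHS](subrK x t) addrC (le_trans (ler_normD _ _))// lerD2l.
  by rewrite ler_norml; lra.
have -> : - noisy_mean (fun y => h y * k (y - x)) x = 'D_1 (noisy_mean h) x.
  rewrite -derive1E (differentiation_under_integral measurableT Ia If Df G0 IG fG).
  rewrite -mulN1r -RintegralZl//; last first.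
    apply: (mul_density_integrable (translated p x) (C := C) measurableT).
      apply: measurable_funM => //; apply: measurableT_comp => //.
      exact: measurable_funB.
    by move=> y; rewrite normrM (le_trans _ (hC y))// ler_piMr.
  apply: eq_Rintegral => y _; rewrite partial1of2E.
  by have [_ ->] := df x y; rewrite mulN1r.
apply: DeriveDef => //.
exact: (derivable_under_integral measurableT Ia If Df G0 IG fG).
Qed.

End bounded.
End score.

(** * Fisher informations under a bounded score *)

Section fisher_informations.
Context (R : realType).
Notation mu := (@lebesgue_measure R).
Variables (p : density R) (k : R -> R).
Hypothesis p_gt0 : forall y, 0 < p y.
Hypothesis derive_p : forall y : R, is_derive y 1 (p : R -> R) (k y * p y).
Hypothesis k_le1 : forall y, `|k y| <= 1.
Hypothesis mk : measurable_fun [set: R] k.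

Let p_neq0 y : p y != 0. Proof. exact: lt0r_neq0. Qed.

Notation P := (additive_channel p).

Let r (x y : R) := p (y - x) / p y.

Let r_measurable x : measurable_fun [set: R] (r x).
Proof.
apply: measurable_funM; first exact: (density_measurable (translated p x)).
apply: continuous_measurable_fun => y; apply: cvgV => //.
by apply/differentiable_continuous/derivable1_diffP; have [] := derive_p y.
Qed.

Let r_le x y : `|r x y| <= expR `|x|.
Proof.
rewrite ger0_norm ?divr_ge0 ?density_ge0// ler_pdivrMr//.
exact: (density_harnack p_gt0 derive_p k_le1).
Qed.

Let r_bounded x : exists C : R, forall y, `|r x y| <= C.
Proof. by exists (expR `|x|); exact: r_le. Qed.

Let additive_channel_ratio x (A : set (measurableTypeR R)) : measurable A ->
  P x A = (\int[P 0%R]_(y in A) (r x y)%:E)%E.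
Proof.
move=> mA; rewrite additive_channelE// /density_prob.
rewrite (integral_additive_channel p 0 mA (r_measurable x) (r_le x)).
by apply: eq_integral => y _; rewrite /r subr0 mulfVK.
Qed.

Lemma additive_overlap_defined : overlap_defined P.
Proof.
exact: (bounded_overlap_defined (T := measurableTypeR R) (P := P) r_measurable
  r_bounded additive_channel_ratio).
Qed.

Let r1_measurable x : measurable_fun [set: R] (fun y => r x y - 1).
Proof. exact: measurable_funB. Qed.

Let r1_le x y : `|r x y - 1| <= expR `|x| + 1.
Proof. by rewrite (le_trans (ler_normB _ _))// normr1 lerD2r. Qed.

(** Multiplying the second factor [r x2 - 1] of the overlap by [p] clears its
    denominator and leaves [p (y - x2) - p y]. *)
Lemma additive_overlapE x1 x2 : overlap P x1 x2 =
  noisy_mean p (fun y => p (y - x1) / p y - 1) x2 -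
  noisy_mean p (fun y => p (y - x1) / p y - 1) 0.
Proof.
rewrite (overlapE (T := measurableTypeR R) (P := P) r_measurable additive_channel_ratio).
rewrite /noisy_mean -RintegralB//; last 2 first.
- exact: (noisy_integrable p (r1_measurable x1) (r1_le x1)).
- exact: (noisy_integrable p (r1_measurable x1) (r1_le x1)).
rewrite {1}/Rintegral.
rewrite (integral_additive_channel p 0 (C := (expR `|x1| + 1) * (expR `|x2| + 1)) measurableT)//.
- apply: eq_Rintegral => y _; rewrite subr0 -mulrBr -mulrA; congr (_ * _).
  by rewrite mulrBl mul1r /r mulfVK.
- exact: measurable_funM.
- by move=> y; rewrite normrM ler_pM.
Qed.

(** At [x2 = 0] the derivative is the integral of [(1 - p (y - x) / p y) * p' y];
    writing [p' = k * p] turns it into a difference of means of [k], which can be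
    differentiated again in [x]. *)
Lemma is_derive_additive_overlap (x : R) : is_derive (0 : R) 1 (overlap P x)
  (noisy_mean p k 0 - noisy_mean p k x).
Proof.
have -> : overlap P x = (fun z => noisy_mean p (fun y => p (y - x) / p y - 1) z -
  noisy_mean p (fun y => p (y - x) / p y - 1) 0).
  by apply/funext => z; exact: additive_overlapE.
have := is_deriveB
  (is_derive_noisy_mean p_gt0 derive_p k_le1 mk (r1_measurable x) (r1_le x) 0)
  (is_derive_cst (noisy_mean p (fun y => p (y - x) / p y - 1) 0) (0 : R) 1).
congr is_derive; rewrite subr0 /noisy_mean.
rewrite -RintegralB//; last 2 first.
- exact: (noisy_integrable p mk k_le1).
- exact: (noisy_integrable p mk k_le1).
rewrite -[LHS]mulN1r -RintegralZl//; last first.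
  apply: (noisy_integrable p (C := expR `|x| + 1)).
    apply: measurable_funM => //; apply: measurableT_comp => //.
    exact: measurable_funB.
  by move=> y; rewrite normrM (le_trans _ (r1_le x y))// ler_piMr//.
apply: eq_Rintegral => y _; rewrite subr0 /r.
have := p_neq0 y; move: (p y) (p (y - x)) (k y) => a b c a0.
by field.
Qed.

Let derive1_overlap : (fun x => derive1 (overlap P x) 0) =
  (fun x => noisy_mean p k 0 - noisy_mean p k x).
Proof.
by apply/funext => x; rewrite derive1E; have [_ ->] := is_derive_additive_overlap x.
Qed.

Let is_derive_derive1_overlap : is_derive (0 : R) 1 (fun x => derive1 (overlap P x) 0)
  (\int[mu]_y (k y ^+ 2 * p y)).
Proof.
rewrite derive1_overlap.
have := is_deriveB (is_derive_cst (noisy_mean p k 0) (0 : R) 1)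
   (is_derive_noisy_mean p_gt0 derive_p k_le1 mk mk k_le1 0).
congr is_derive; rewrite sub0r opprK; apply: eq_Rintegral => y _.
by rewrite subr0 expr2.
Qed.

Lemma additive_fisher_defined : fisher_defined P.
Proof.
split; first exact: additive_overlap_defined.
- by near=> x; have [] := is_derive_additive_overlap x.
- by have [] := is_derive_derive1_overlap.
Unshelve. all: by end_near. Qed.

Lemma additive_fisherE : fisher P = \int[mu]_y (k y ^+ 2 * p y).
Proof. by rewrite /fisher derive1E; have [_ ->] := is_derive_derive1_overlap. Qed.

Section sign.
Variable b : bool.
Notation s := (@sign_at0 R b).
Hypothesis s_mean0 : noisy_mean p s 0 = 0.

Lemma sign_at0_sqr y : s y * s y = 1.
Proof.
rewrite /sign_at0; case: eqP => [_|/eqP y0]; first by rewrite -signr_addb addbb.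
by rewrite -expr2 sqr_sg y0.
Qed.

Lemma norm_sign_at0 y : `|s y| = 1.
Proof.
apply/eqP; rewrite -(eqrXn2 (n := 2))// expr1n -normrX expr2.
by rewrite sign_at0_sqr normr1.
Qed.

Lemma sign_at0_idem y : s (s y) = s y.
Proof.
rewrite {1}/sign_at0; case: eqP => [s0|_].
  by have := norm_sign_at0 y; rewrite s0 normr0 => /eqP; rewrite eq_sym oner_eq0.
rewrite /sign_at0; case: ifP => _; last exact: sgr_id.
by case: (b); rewrite ?expr1 ?expr0 ?sgrN ?sgr1.
Qed.

(** A function of a sign is affine in that sign. *)
Lemma sign_at0_interp (f : R -> R) y :
  f (s y) = (f 1 + f (-1)) / 2 + (f 1 - f (-1)) / 2 * s y.
Proof.
have : (s y - 1) * (s y + 1) = 0 by rewrite mulrDr mulrBl sign_at0_sqr; ring.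
move/eqP; rewrite mulf_eq0 subr_eq0 addr_eq0 => /orP[]/eqP ->; by field.
Qed.

Let ms : measurable_fun [set: R] s := measurable_sign_at0 b.

Let s_le1 y : `|s y| <= 1. Proof. by rewrite norm_sign_at0. Qed.

Let affine_sign_mean x (a c : R) :
  (\int[P x]_y (a + c * s y)%:E = (a + c * noisy_mean p s x)%:E)%E.
Proof.
have is_ : (P x).-integrable [set: R] (EFin \o s) := bounded_integrable (P x) ms s_le1.
rewrite integralD_EFin//; last 2 first.
- exact: finite_measure_integrable_cst.
- exact: (integrableZl measurableT c is_).
have PT : P x [set: measurableTypeR R] = 1%E by exact: probability_setT.
rewrite integral_cst// [X in (_ * X + _)%E]PT mule1 EFinD; congr (_ + _)%E.
by rewrite EFinM -(integral_noisy p ms s_le1) -integralZl.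
Qed.

Notation Q := (sgn_channel b P).
Notation G := (noisy_mean p s).

(** The likelihood ratio of the sign at input [x]. Applying [s] to the sign
    [v] keeps the function bounded outside of the two values that occur. *)
Let q (x v : R) := 1 + s v * G x.

Let q_measurable x : measurable_fun [set: R] (q x).
Proof. by apply: measurable_funD => //; apply: measurable_funM. Qed.

Let q_le x : exists C : R, forall v, `|q x v| <= C.
Proof.
exists (1 + `|G x|) => v; rewrite (le_trans (ler_normD _ _))// normr1 lerD2l.
by rewrite normrM norm_sign_at0 mul1r.
Qed.

(** Both sides are means of affine functions of [s], under the inputs [x] and
    [0], which [affine_sign_mean] evaluates in terms of [G x] and [G 0 = 0]. *)
Let sgn_channel_ratio x (A : set (measurableTypeR R)) : measurable A ->
  Q x A = (\int[Q 0%R]_(v in A) (q x v)%:E)%E.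
Proof.
move=> mA; pose B := s @^-1` A.
have mB : measurable B by rewrite -[B]setTI; exact: ms.
pose al : R := (\1_A 1 + \1_A (-1)) / 2.
pose be : R := (\1_A 1 - \1_A (-1)) / 2.
have indE y : \1_B y = al + be * s y by exact: (sign_at0_interp \1_A).
transitivity (\int[P x]_y (al + be * s y)%:E)%E.
  rewrite [LHS](_ : _ = P x (B `&` [set: _])); last by rewrite setIT.
  rewrite -integral_indic//.
  by apply: eq_integral => y _; rewrite indE.
rewrite affine_sign_mean.
have qs y : q x (s y) = 1 + G x * s y by rewrite /q sign_at0_idem mulrC.
rewrite integral_pushforward//; last 2 first.
- by apply/measurable_EFinP; exact: q_measurable.
- apply: (integrableS measurableT) => //.
  have qs_le y : `|1 + G x * s y| <= 1 + `|G x|.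
    rewrite (le_trans (ler_normD _ _))// normr1 lerD2l normrM.
    by rewrite norm_sign_at0 mulr1.
  apply: (eq_integrable measurableT _ _ _ (bounded_integrable (P 0) _ qs_le)).
    by move=> y _; rewrite /= qs.
  by apply: measurable_funD => //; apply: measurable_funM.
rewrite integral_mkcond epatch_indic.
transitivity (\int[P 0%R]_y (al + be * G x + (be + al * G x) * s y)%:E)%E.
  by rewrite affine_sign_mean s_mean0 mulr0 addr0.
apply: eq_integral => y _ /=; rewrite qs -EFinM indE; congr EFin.
have := sign_at0_sqr y; move: (s y) => v v2; apply: subr0_eq.
by transitivity (be * G x * (1 - v * v)); [ring|rewrite v2 subrr mulr0].
Qed.

Lemma sgn_overlap_defined : overlap_defined Q.
Proof.
exact: (bounded_overlap_defined (T := measurableTypeR R) (P := Q) q_measurable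
  q_le sgn_channel_ratio).
Qed.

Lemma sgn_overlapE x1 x2 : overlap Q x1 x2 = G x1 * G x2.
Proof.
rewrite (overlapE (T := measurableTypeR R) (P := Q) q_measurable sgn_channel_ratio).
transitivity (\int[Q 0]_(_ in [set: R]) (G x1 * G x2)).
  apply: eq_Rintegral => v _; rewrite /q !(addrC 1) !addrK mulrACA.
  by rewrite sign_at0_sqr mul1r.
rewrite Rintegral_cst//.
have QT : Q 0 [set: measurableTypeR R] = 1%E by exact: probability_setT.
by rewrite [X in _ * fine X]QT mulr1.
Qed.

Let dG := - noisy_mean p (fun y => s y * k y) 0.

Let is_derive_G : is_derive (0 : R) 1 G dG.
Proof.
have := is_derive_noisy_mean p_gt0 derive_p k_le1 mk ms s_le1 0.
congr is_derive; congr (- _); apply: eq_Rintegral => y _.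
by rewrite subr0.
Qed.

Let is_derive_sgn_overlap x : is_derive (0 : R) 1 (overlap Q x) (G x * dG).
Proof.
rewrite (_ : overlap Q x = G x \*: G); last first.
  by apply/funext => z; exact: sgn_overlapE.
exact: is_deriveZ.
Qed.

Let is_derive_derive1_sgn_overlap :
  is_derive (0 : R) 1 (fun x => derive1 (overlap Q x) 0) (dG ^+ 2).
Proof.
rewrite (_ : (fun x => _) = dG \*: G); first exact: is_deriveZ.
apply/funext => x; rewrite derive1E.
by have [_ ->] := is_derive_sgn_overlap x; rewrite mulrC.
Qed.

Lemma sgn_fisher_defined : fisher_defined Q.
Proof.
split; first exact: sgn_overlap_defined.
- by near=> x; have [] := is_derive_sgn_overlap x.
- by have [] := is_derive_derive1_sgn_overlap.
Unshelve. all: by end_near. Qed.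

Lemma sgn_fisherE : fisher Q = (\int[mu]_y (s y * k y * p y)) ^+ 2.
Proof.
rewrite /fisher derive1E; have [_ ->] := is_derive_derive1_sgn_overlap.
rewrite /dG sqrrN; congr (_ ^+ 2); apply: eq_Rintegral => y _.
by rewrite subr0.
Qed.

(** The Cauchy-Schwarz inequality in the form [0 <= E[(k - m * s) ^ 2]] with
    [m = E[s * k]] and [s ^ 2 = 1]. *)
Lemma sgn_fisher_le : fisher Q <= fisher P.
Proof.
rewrite sgn_fisherE additive_fisherE.
set m := \int[mu]_y (s y * k y * p y).
have sk_le y : `|s y * k y| <= 1 by rewrite normrM norm_sign_at0 mul1r.
have k2_le y : `|k y ^+ 2| <= 1 by rewrite normrX expr_le1.
have msk : measurable_fun [set: R] (fun y => s y * k y) by exact: measurable_funM.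
have mk2 : measurable_fun [set: R] (fun y => k y ^+ 2) by exact: measurable_funX.
have Isk := mul_density_integrable p measurableT msk sk_le.
have Ik2 := mul_density_integrable p measurableT mk2 k2_le.
have Ip := density_integrable p.
have : 0 <= \int[mu]_y (k y ^+ 2 * p y - (2 * m * (s y * k y * p y) - m ^+ 2 * p y)).
  apply: Rintegral_ge0 => y _.
  rewrite [leRHS](_ : _ = (k y - m * s y) ^+ 2 * p y).
    by rewrite mulr_ge0 ?sqr_ge0 ?density_ge0.
  have := sign_at0_sqr y; move: (s y) => v v2; apply: subr0_eq.
  transitivity (m ^+ 2 * p y * (1 - v * v)); first by ring.
  by rewrite v2 subrr mulr0.
have I1 := integrableZl measurableT (2 * m) Isk.
have I2 := integrableZl measurableT (m ^+ 2) Ip.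
rewrite RintegralB//; last exact: (integrableB measurableT I1 I2).
rewrite RintegralB// !RintegralZl// -/m.
rewrite [\int[mu]_x p x](_ : _ = 1); last by rewrite /Rintegral density_int1.
by rewrite mulr1; lra.
Qed.

End sign.

End fisher_informations.

(** * Integrals of even functions *)

Section even_functions.
Context (R : realType).
Notation mu := (@lebesgue_measure R).

(** Each half line contributes [F 0], as [F] decreases from there to [0] with
    derivative [- f]. *)
Lemma even_integral_FTC (f F : R -> R) :
  (forall y, 0 <= f y) -> continuous f -> f =1 f \o -%R ->
  (forall y : R, 0 < y -> is_derive y 1 F (- f y)) ->
  F y @[y --> 0^'+] --> F 0 -> F y @[y --> +oo] --> (0 : R) ->
  (\int[mu]_y (f y)%:E = (2 * F 0)%:E)%E.
Proof.
move=> f0 cf evenf dF F0 Foo.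
rewrite ge0_symfun_integralT// EFinM; congr (_ * _)%E.
rewrite -set_itvcy (ge0_continuous_FTC2y (F := fun y => - F y) (l := 0))//.
- by rewrite EFinN oppeK add0e.
- exact: continuous_subspaceT.
- by rewrite -oppr0; exact: cvgN.
- by move=> y y0; have [] := is_deriveN (dF y y0).
- exact: cvgN.
- move=> y; rewrite in_itv/= andbT => y0; rewrite derive1E.
  by have [_ ->] := is_deriveN (dF y y0); rewrite opprK.
Qed.

(** An even density gives mass [1 / 2] to each half line, and the origin, where
    the sign is chosen by [b], has measure zero. *)
Lemma even_sign_mean0 (b : bool) (p : density R) : continuous (p : R -> R) ->
  (p : R -> R) =1 p \o -%R -> noisy_mean p (@sign_at0 R b) 0 = 0.
Proof.
move=> cp evenp.
have ms : measurable_fun [set: R] (@sign_at0 R b) := measurable_sign_at0 b.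
have s_le1 y : `|@sign_at0 R b y| <= 1 by rewrite norm_sign_at0.
have I : mu.-integrable [set: R] (EFin \o (fun y => @sign_at0 R b y * p y)).
  exact: (mul_density_integrable p measurableT ms s_le1).
have Ip := density_integrable p.
have half : \int[mu]_(y in `[0, +oo[) p y = 2^-1.
  have /(congr1 fine) := ge0_symfun_integralT (@density_ge0 _ p) cp evenp.
  rewrite density_int1 -set_itvcy fineM//; last first.
    apply: integrable_fin_num => //.
    by apply: (integrableS measurableT) => //; exact: Ip.
  by rewrite /Rintegral /= => /(congr1 ( *%R 2^-1)); rewrite mulrA mulVf// mulr1 mul1r.
have split_int (g : R -> R) : mu.-integrable [set: R] (EFin \o g) ->
    \int[mu]_y g y = \int[mu]_(y in `]-oo, 0[) g y + \int[mu]_(y in `[0, +oo[) g y.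
  move=> Ig; rewrite -Rintegral_setU//.
  - by congr Rintegral; rewrite -setCitvl setUv.
  - by rewrite -setCitvl setUv.
  - by apply/disj_setPS; rewrite -setCitvl setICr.
have pos : \int[mu]_(y in `[0, +oo[) (@sign_at0 R b y * p y) = 2^-1.
  rewrite -half -!Rintegral_itv_obnd_cbnd; last 2 first.
  - by apply: (integrableS measurableT) => //; exact: Ip.
  - by apply: (integrableS measurableT) => //; exact: I.
  apply: eq_Rintegral => y; rewrite inE/= in_itv/= andbT => y0.
  by rewrite /sign_at0 gt_eqF// gtr0_sg// mul1r.
have neg : \int[mu]_(y in `]-oo, 0[) (@sign_at0 R b y * p y) = - \int[mu]_(y in `]-oo, 0[) p y.
  rewrite -[RHS]mulN1r -RintegralZl//; last by apply: (integrableS measurableT) => //; exact: Ip.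
  apply: eq_Rintegral => y; rewrite inE/= in_itv/= => y0.
  by rewrite /sign_at0 lt_eqF// ltr0_sg.
have one : \int[mu]_y p y = 1 by rewrite /Rintegral density_int1.
rewrite /noisy_mean; under eq_Rintegral do rewrite subr0.
move: one; rewrite (split_int _ Ip) (split_int _ I) pos neg half; lra.
Qed.

End even_functions.

(** * The hyperbolic density *)

Section hyperbolic.
Context (R : realType).
Notation mu := (@lebesgue_measure R).
Implicit Types d y : R.

Definition soft_abs d y := Num.sqrt (y ^+ 2 + d ^+ 2).

Lemma soft_abs_ge d y : `|y| <= soft_abs d y.
Proof. by rewrite -sqrtr_sqr ler_sqrt ?lerDl ?addr_ge0 ?sqr_ge0. Qed.

Lemma soft_abs_le d y : soft_abs d y <= `|y| + `|d|.
Proof.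
rewrite -[leRHS]ger0_norm ?addr_ge0// -sqrtr_sqr ler_sqrt ?sqr_ge0//.
by rewrite sqrrD !real_normK ?num_real// lerD2r lerDl mulrn_wge0 ?mulr_ge0.
Qed.

Lemma soft_abs0 y : soft_abs 0 y = `|y|.
Proof. by rewrite /soft_abs expr0n addr0 sqrtr_sqr. Qed.

Lemma soft_abs_even d y : soft_abs d (- y) = soft_abs d y.
Proof. by rewrite /soft_abs sqrrN. Qed.

Lemma soft_abs_gt0 d y : d != 0 -> 0 < soft_abs d y.
Proof. by move=> d0; rewrite sqrtr_gt0 ltr_wpDl ?sqr_ge0// exprn_even_gt0. Qed.

Lemma soft_abs_continuous d : continuous (soft_abs d).
Proof.
move=> y; apply: (@continuous_comp _ _ _ (fun y => y ^+ 2 + d ^+ 2)); last exact: sqrt_continuous.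
by apply: cvgD; [exact: exprn_continuous|exact: cvg_cst].
Qed.

Lemma soft_abs_continuousr y : continuous (soft_abs ^~ y).
Proof.
move=> d; apply: (@continuous_comp _ _ _ (fun d => y ^+ 2 + d ^+ 2)); last exact: sqrt_continuous.
by apply: cvgD; [exact: cvg_cst|exact: exprn_continuous].
Qed.

Definition unnormalized d y := expR (- soft_abs d y).

Lemma unnormalized_continuous d : continuous (unnormalized d).
Proof.
move=> y; apply: (@continuous_comp _ _ _ (fun y => - soft_abs d y)); last exact: continuous_expR.
by apply: cvgN; exact: soft_abs_continuous.
Qed.

Lemma unnormalized_measurable d : measurable_fun [set: R] (unnormalized d).
Proof. by apply: continuous_measurable_fun; exact: unnormalized_continuous. Qed.

Lemma unnormalized_le d y : unnormalized d y <= unnormalized 0 y.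
Proof. by rewrite ler_expR lerN2 soft_abs0 soft_abs_ge. Qed.

Lemma unnormalized_ge d y : expR (- `|d|) * unnormalized 0 y <= unnormalized d y.
Proof. by rewrite -expRD ler_expR soft_abs0 -opprD lerN2 addrC soft_abs_le. Qed.

Lemma unnormalized_cvg0 d : unnormalized d y @[y --> +oo] --> (0 : R).
Proof.
apply: (@squeeze_cvgr _ _ _ _ (fun=> 0) (fun y => expR (- y))).
- near=> y; rewrite expR_ge0 ler_expR lerN2 (le_trans _ (soft_abs_ge d y))//.
  exact: ler_norm.
- exact: cvg_cst.
- exact: cvgr_expR.
Unshelve. all: by end_near. Qed.

Lemma integral_unnormalized0 : (\int[mu]_y (unnormalized 0 y)%:E = 2%:E)%E.
Proof.
transitivity (2 * expR (- (0 : R)))%:E; last by rewrite oppr0 expR0 mulr1.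
apply: (even_integral_FTC (F := fun y => expR (- y))).
- by move=> y; exact: expR_ge0.
- exact: unnormalized_continuous.
- by move=> y; rewrite /= /unnormalized soft_abs_even.
- move=> y y0; rewrite /unnormalized soft_abs0 gtr0_norm//.
  by apply: is_derive_eq; rewrite mulrN1.
- apply: cvg_at_right_filter.
  apply: (@continuous_comp _ _ _ -%R); last exact: continuous_expR.
  exact: opp_continuous.
- exact: cvgr_expR.
Qed.

Lemma unnormalized_integrable d : mu.-integrable [set: R] (EFin \o unnormalized d).
Proof.
have I0 : mu.-integrable [set: R] (EFin \o unnormalized 0).
  apply/integrableP; split.
    by apply/measurable_EFinP; exact: unnormalized_measurable.
  under eq_integral => y _ do rewrite /= ger0_norm ?expR_ge0//.
  by rewrite integral_unnormalized0 ltry.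
apply: le_integrable I0 => //.
  by apply/measurable_EFinP; exact: unnormalized_measurable.
by move=> y _ /=; rewrite lee_fin !ger0_norm ?expR_ge0// unnormalized_le.
Qed.

Definition normalizer d := \int[mu]_y unnormalized d y.

Lemma normalizer0 : normalizer 0 = 2.
Proof. by rewrite /normalizer /Rintegral integral_unnormalized0. Qed.

Lemma normalizer_le d : normalizer d <= 2.
Proof.
rewrite -normalizer0; apply: le_Rintegral => //; try exact: unnormalized_integrable.
by move=> y _; exact: unnormalized_le.
Qed.

(** With [normalizer_le], this confines the normalizer near its value [2] at
    [d = 0], which avoids computing it. *)
Lemma normalizer_ge d : expR (- `|d|) * 2 <= normalizer d.
Proof.
rewrite -normalizer0 -RintegralZl//; last exact: unnormalized_integrable.
apply: le_Rintegral => //.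
- exact: (integrableZl measurableT _ (unnormalized_integrable 0)).
- exact: unnormalized_integrable.
- by move=> y _; exact: unnormalized_ge.
Qed.

Lemma normalizer_gt0 d : 0 < normalizer d.
Proof. by rewrite (lt_le_trans _ (normalizer_ge d))// mulr_gt0 ?expR_gt0. Qed.

Definition hyperbolic_fun d y := unnormalized d y / normalizer d.

Lemma hyperbolic_fun_gt0 d y : 0 < hyperbolic_fun d y.
Proof. by rewrite divr_gt0 ?expR_gt0 ?normalizer_gt0. Qed.

Lemma hyperbolic_continuous d : continuous (hyperbolic_fun d).
Proof. by move=> y; apply: cvgM; [exact: unnormalized_continuous|exact: cvg_cst]. Qed.

Lemma hyperbolic_measurable d : measurable_fun [set: R] (hyperbolic_fun d).
Proof. by apply: continuous_measurable_fun; exact: hyperbolic_continuous. Qed.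

Lemma hyperbolic_int1 d : (\int[mu]_y (hyperbolic_fun d y)%:E = 1)%E.
Proof.
rewrite /hyperbolic_fun.
have -> : (\int[mu]_y (unnormalized d y / normalizer d)%:E =
    (\int[mu]_y (unnormalized d y / normalizer d))%:E)%E.
  rewrite fineK//; apply: integrable_fin_num => //.
  exact: (integrableZr measurableT _ (unnormalized_integrable d)).
rewrite RintegralZr//; last exact: unnormalized_integrable.
by rewrite divff ?lt0r_neq0 ?normalizer_gt0.
Qed.

(** The symmetric hyperbolic distribution; at [d = 0] it is the Laplace
    distribution. *)
Definition hyperbolic d : density R := Density (@hyperbolic_measurable d)
  (fun y => ltW (hyperbolic_fun_gt0 d y)) (hyperbolic_int1 d).

Lemma hyperbolic_gt0 d y : 0 < hyperbolic d y.
Proof. exact: hyperbolic_fun_gt0. Qed.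

End hyperbolic.

(** * Smoothness and Fisher informations of the hyperbolic density *)

Section smoothness.
Context (R : realType) (d : R).
Hypothesis d0 : d != 0.

(** Derivatives of the hyperbolic density of every order are polynomials in
    [y], [1 / soft_abs d y] and the exponential factor: this class of functions is
    closed under differentiation. *)
Inductive hyperbolic_algebra : (R -> R) -> Prop :=
| Alg_cst c : hyperbolic_algebra (fun=> c)
| Alg_id : hyperbolic_algebra id
| Alg_inv : hyperbolic_algebra (fun y => (soft_abs d y)^-1)
| Alg_exp : hyperbolic_algebra (unnormalized d)
| Alg_add f g : hyperbolic_algebra f -> hyperbolic_algebra g ->
    hyperbolic_algebra (f \+ g)
| Alg_mul f g : hyperbolic_algebra f -> hyperbolic_algebra g ->
    hyperbolic_algebra (f \* g).

Lemma is_derive_soft_abs (y : R) : is_derive y 1 (soft_abs d) (y / soft_abs d y).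
Proof.
have sq : 0 < y ^+ 2 + d ^+ 2 by rewrite -sqrtr_gt0; exact: soft_abs_gt0.
have dq : is_derive y (1 : R) (fun z : R => z ^+ 2 + d ^+ 2) (2 * y).
  by apply: is_derive_eq; rewrite /GRing.scale/=; ring.
have := is_derive1_comp (g := fun z : R => z ^+ 2 + d ^+ 2) (is_derive1_sqrt sq) dq.
congr is_derive; rewrite -/(soft_abs d y).
have := lt0r_neq0 (soft_abs_gt0 y d0); move: (soft_abs d y) => s s0.
by field.
Qed.

Lemma is_derive_unnormalized (y : R) :
  is_derive y 1 (unnormalized d) (- (y / soft_abs d y) * unnormalized d y).
Proof.
have := is_derive1_comp (g := fun z => - soft_abs d z)
  (is_derive_expR (- soft_abs d y)) (is_deriveN (is_derive_soft_abs y)).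
by congr is_derive; rewrite mulrC.
Qed.

Lemma hyperbolic_algebra_derive f : hyperbolic_algebra f ->
  exists2 g, hyperbolic_algebra g & forall y : R, is_derive y 1 f (g y).
Proof.
elim => [c|||| {}f g Af [f' Af' ff'] Ag [g' Ag' gg'] |{}f g Af [f' Af' ff'] Ag [g' Ag' gg']].
- by exists (fun=> 0); [exact: Alg_cst|move=> y; exact: is_derive_cst].
- by exists (fun=> 1); [exact: Alg_cst|move=> y; exact: is_derive_id].
- pose i y := (soft_abs d y)^-1.
  exists ((fun=> -1) \* (id \* (i \* (i \* i)))).
    by do ![apply: Alg_mul]; try exact: Alg_inv; [exact: Alg_cst|exact: Alg_id].
  move=> y; have s0 := lt0r_neq0 (soft_abs_gt0 y d0).
  have := is_deriveV s0 (is_derive_soft_abs y).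
  congr is_derive; rewrite /i /GRing.scale/=.
  by move: (soft_abs d y) s0 => s s0; field.
- exists ((fun=> -1) \* (id \* (fun y => (soft_abs d y)^-1)) \* unnormalized d).
    do ![apply: Alg_mul]; [exact: Alg_cst|exact: Alg_id|exact: Alg_inv|exact: Alg_exp].
  by move=> y; have := is_derive_unnormalized y; congr is_derive; rewrite /= mulN1r.
- by exists (f' \+ g'); [exact: Alg_add|move=> y; exact: is_deriveD].
- exists ((f \* g') \+ (g \* f')).
    by apply: Alg_add; exact: Alg_mul.
  by move=> y; exact: is_deriveM.
Qed.

Lemma hyperbolic_algebra_smooth f : hyperbolic_algebra f -> smooth f.
Proof.
move=> Af n y.
have : hyperbolic_algebra (derive1n n f).
  elim: n => [//|n IH]; rewrite derive1nS.
  have [g Ag fg] := hyperbolic_algebra_derive IH.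
  rewrite (_ : derive1 _ = g)//; apply/funext => z; rewrite derive1E.
  by have [_ ->] := fg z.
by move=> /hyperbolic_algebra_derive[g _ /(_ y)[]].
Qed.

Lemma hyperbolic_smooth : smooth (hyperbolic d).
Proof. by apply: hyperbolic_algebra_smooth; apply: Alg_mul; [exact: Alg_exp|exact: Alg_cst]. Qed.

Definition hyperbolic_score (y : R) := - (y / soft_abs d y).

Lemma is_derive_hyperbolic (y : R) : is_derive y 1 (hyperbolic d : R -> R)
  (hyperbolic_score y * hyperbolic d y).
Proof.
have := is_deriveM (is_derive_unnormalized y) (is_derive_cst (normalizer d)^-1 y 1).
congr is_derive; rewrite scaler0 add0r /GRing.scale/=.
by rewrite /hyperbolic_fun /hyperbolic_score; ring.
Qed.

Lemma hyperbolic_score_le1 y : `|hyperbolic_score y| <= 1.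
Proof.
rewrite normrN normrM normfV (gtr0_norm (soft_abs_gt0 y d0)).
by rewrite ler_pdivrMr ?soft_abs_gt0// mul1r soft_abs_ge.
Qed.

Lemma hyperbolic_score_continuous : continuous hyperbolic_score.
Proof.
move=> y; apply: cvgN; apply: cvgM; first exact: cvg_id.
by apply: cvgV; [exact/lt0r_neq0/soft_abs_gt0|exact: soft_abs_continuous].
Qed.

Lemma hyperbolic_score_measurable : measurable_fun [set: R] hyperbolic_score.
Proof. by apply: continuous_measurable_fun; exact: hyperbolic_score_continuous. Qed.

Lemma hyperbolic_even : (hyperbolic d : R -> R) =1 hyperbolic d \o -%R.
Proof. by move=> y; rewrite /= /hyperbolic_fun /unnormalized soft_abs_even. Qed.

Lemma hyperbolic_cvg0 : hyperbolic d y @[y --> +oo] --> (0 : R).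
Proof.
rewrite -(mul0r (normalizer d)^-1).
by apply: cvgM; [exact: unnormalized_cvg0|exact: cvg_cst].
Qed.

(** On the positive half line [|k| * p = - p'], so the density itself is the
    primitive to use in [even_integral_FTC]. *)
Lemma integral_norm_score :
  \int[lebesgue_measure]_y (`|hyperbolic_score y| * hyperbolic d y) = 2 * hyperbolic d 0.
Proof.
rewrite /Rintegral.
rewrite (_ : (\int[_]_y _ = (2 * hyperbolic d 0)%:E)%E)//.
apply: (even_integral_FTC (F := hyperbolic d)).
- by move=> y; rewrite mulr_ge0// density_ge0.
- move=> y; apply: cvgM; last exact: hyperbolic_continuous.
  by apply: cvg_norm; exact: hyperbolic_score_continuous.
- move=> y; rewrite /= /hyperbolic_score /hyperbolic_fun /unnormalized.
  by rewrite soft_abs_even mulNr !normrN.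
- move=> y y0; have := is_derive_hyperbolic y; congr is_derive.
  rewrite -mulNr; congr (_ * _); rewrite ler0_norm ?opprK// /hyperbolic_score.
  by rewrite oppr_le0 divr_ge0 ?ltW// soft_abs_gt0.
- by apply: cvg_at_right_filter; exact: hyperbolic_continuous.
- exact: hyperbolic_cvg0.
Qed.

(** The score has the sign opposite to [y]; at [y = 0], where the sign is
    chosen by [b], the score vanishes. *)
Lemma sign_hyperbolic_score b y : @sign_at0 R b y * hyperbolic_score y = - `|hyperbolic_score y|.
Proof.
rewrite /sign_at0 /hyperbolic_score; case: eqP => [->|_].
  by rewrite mul0r oppr0 normr0 mulr0 oppr0.
rewrite mulrN normrN normrM normfV (gtr0_norm (soft_abs_gt0 y d0)) mulrA.
by rewrite -normrEsg.
Qed.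

Lemma hyperbolic_sign_mean0 b : noisy_mean (hyperbolic d) (@sign_at0 R b) 0 = 0.
Proof. by apply: even_sign_mean0; [exact: hyperbolic_continuous|exact: hyperbolic_even]. Qed.

Notation P := (additive_channel (hyperbolic d)).
Let k := hyperbolic_score.

Lemma hyperbolic_fisher_ge0 : 0 <= fisher P.
Proof.
rewrite (additive_fisherE (hyperbolic_gt0 d) is_derive_hyperbolic hyperbolic_score_le1
  hyperbolic_score_measurable).
by apply: Rintegral_ge0 => y _; rewrite mulr_ge0 ?sqr_ge0 ?density_ge0.
Qed.

Lemma hyperbolic_fisher_le1 : fisher P <= 1.
Proof.
rewrite (additive_fisherE (hyperbolic_gt0 d) is_derive_hyperbolic hyperbolic_score_le1
  hyperbolic_score_measurable).
have k2 y : `|k y ^+ 2| <= 1 by rewrite normrX expr_le1// hyperbolic_score_le1.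
rewrite [leRHS](_ : _ = \int[lebesgue_measure]_y hyperbolic d y); last first.
  by rewrite /Rintegral density_int1.
apply: le_Rintegral => //.
- apply: (mul_density_integrable (hyperbolic d) measurableT _ k2).
  by apply: measurable_funX; exact: hyperbolic_score_measurable.
- exact: density_integrable.
- move=> y _; rewrite ler_piMl ?density_ge0//.
  by rewrite (le_trans (ler_norm _)).
Qed.

Lemma hyperbolic_sgn_fisherE b : fisher (sgn_channel b P) = (2 * hyperbolic d 0) ^+ 2.
Proof.
rewrite (sgn_fisherE (hyperbolic_gt0 d) is_derive_hyperbolic hyperbolic_score_le1
  hyperbolic_score_measurable (hyperbolic_sign_mean0 b)).
rewrite -integral_norm_score -sqrrN; congr (_ ^+ 2).
rewrite -mulN1r -RintegralZl//; last first.
  apply: (mul_density_integrable (hyperbolic d) (C := 1) measurableT).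
    apply: measurable_funM; first exact: measurable_sign_at0.
    exact: hyperbolic_score_measurable.
  by move=> y; rewrite normrM norm_sign_at0 mul1r hyperbolic_score_le1.
by apply: eq_Rintegral => y _; rewrite sign_hyperbolic_score !mulNr mul1r opprK.
Qed.

(** The peak value [hyperbolic d 0 = exp (- |d|) / normalizer d] is at least
    [exp (- |d|) / 2] by [normalizer_le]. *)
Lemma hyperbolic_sgn_fisher_ge b :
  expR (- (2 * `|d|)) <= fisher (sgn_channel b P).
Proof.
have le0 : expR (- `|d|) <= 2 * hyperbolic d 0.
  rewrite /= /hyperbolic_fun /unnormalized /soft_abs expr0n add0r sqrtr_sqr.
  rewrite mulrA ler_pdivlMr ?normalizer_gt0// mulrC.
  by rewrite ler_pM2r ?expR_gt0// normalizer_le.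
rewrite hyperbolic_sgn_fisherE mulr_natl mulr2n opprD expRD -expr2.
by rewrite lerXn2r// nnegrE ?expR_ge0// (le_trans _ le0)// expR_ge0.
Qed.

End smoothness.

(** * The Laplace limit *)

Lemma normalizer_cvg (R : realType) : @normalizer R d @[d --> 0] --> normalizer 0.
Proof.
rewrite normalizer0.
apply: (@squeeze_cvgr _ _ _ _ (fun d => expR (- `|d|) * 2) (fun=> 2)).
- by apply: nearW => d; rewrite normalizer_ge normalizer_le.
- rewrite -[X in _ --> X]mul1r; apply: cvgM; last exact: cvg_cst.
  rewrite -expR0 -[X in expR X]oppr0 -[X in expR (- X)](@normr0 R R).
  apply: (@continuous_comp _ _ _ (fun d : R => - `|d|)); last exact: continuous_expR.
  by apply: cvgN; exact: norm_continuous.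
- exact: cvg_cst.
Qed.

Lemma hyperbolic_cvg (R : realType) (y : R) :
  hyperbolic d y @[d --> 0] --> hyperbolic 0 y.
Proof.
apply: cvgM.
  apply: (@continuous_comp _ _ _ (fun d => - soft_abs d y)); last exact: continuous_expR.
  by apply: cvgN; exact: soft_abs_continuousr.
by apply: cvgV; [exact/lt0r_neq0/normalizer_gt0|exact: normalizer_cvg].
Qed.

Lemma hyperbolic0E (R : realType) (y : R) : hyperbolic 0 y = 2^-1 * expR (- `|y|).
Proof. by rewrite /= /hyperbolic_fun /unnormalized soft_abs0 normalizer0 mulrC. Qed.

Lemma norm_not_derivable0 (R : realType) : ~ derivable (@Num.norm R R) (0 : R) 1.
Proof.
move=> /cvg_ex[/= l dl].
have r : (h^-1 *: (`|h *: (1 : R) + 0| - `|(0 : R)|)) @[h --> (0 : R)^'+] --> (1 : R).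
  apply: cvg_near_cst; near=> h.
  have h0 : 0 < h by near: h; exact: nbhs_right_gt.
  by rewrite addr0 normr0 subr0 scaler1 gtr0_norm// /GRing.scale/= mulVf ?gt_eqF.
have l' : (h^-1 *: (`|h *: (1 : R) + 0| - `|(0 : R)|)) @[h --> (0 : R)^'-] --> (-1 : R).
  apply: cvg_near_cst; near=> h.
  have h0 : h < 0 by near: h; exact: nbhs_left_lt.
  by rewrite addr0 normr0 subr0 scaler1 ltr0_norm// /GRing.scale/= mulrN mulVf ?lt_eqF.
have u1 := @cvg_unique _ (@Rhausdorff R) _ _ _ _ (cvg_dnbhs_at_right dl) r.
have u2 := @cvg_unique _ (@Rhausdorff R) _ _ _ _ (cvg_dnbhs_at_left dl) l'.
have l1 := u1 (fmap_proper_filter _ (at_right_proper_filter _)).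
have l2 := u2 (fmap_proper_filter _ (at_left_proper_filter _)).
move: l1; rewrite l2 => /esym/eqP.
by rewrite -subr_eq0 opprK -(natrD R 1 1) pnatr_eq0.
Unshelve. all: by end_near. Qed.

(** If the Laplace density were differentiable at [0], then so would be
    [|y| = - ln (2 * hyperbolic 0 y)]. *)
Lemma hyperbolic0_not_smooth (R : realType) : ~ smooth (@hyperbolic R 0).
Proof.
move=> /(_ 0 0); rewrite derive1n0 => dp.
apply: (@norm_not_derivable0 R).
rewrite (_ : Num.norm = (fun y => - ln (2 * hyperbolic 0 y))); last first.
  by apply/funext => y; rewrite hyperbolic0E mulrA divff// mul1r expRK opprK.
have dp2 := is_deriveZ 2 (derivableP dp).
have p0 : 0 < 2 * hyperbolic (0 : R) 0 by rewrite mulr_gt0 ?hyperbolic_gt0.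
by have [] := is_deriveN (is_derive1_comp (g := fun y => 2 * hyperbolic 0 y)
  (is_derive1_ln p0) dp2).
Qed.

(** * Choice of the family *)

Theorem corollary3p34 (R : realType) :
  exists (p : R -> density R) (p0 : density R),
    [/\ forall eps : R, 0 < eps ->
          [/\ smooth (p eps), (forall y : R, 0 < p eps y),
              fisher_defined (additive_channel (p eps)) &
              forall b : bool,
                let P := additive_channel (p eps) in
                [/\ fisher_defined (sgn_channel b P),
                    (1 - eps) * fisher P <= fisher (sgn_channel b P) &
                    fisher (sgn_channel b P) <= fisher P]],
        (forall y : R, p0 y = 2^-1 * expR (- `|y|)),
        (forall y : R, 0 < p0 y),
        ~ smooth p0 &
        forall y : R, p eps y @[eps --> 0^'+] --> p0 y].
Proof.
exists (fun eps => hyperbolic (eps / 2)), (hyperbolic 0); split.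
- move=> eps eps0.
  have d0 : eps / 2 != 0 by rewrite lt0r_neq0// divr_gt0.
  have p0 := hyperbolic_gt0 (eps / 2).
  have dp := is_derive_hyperbolic d0.
  have k1 := hyperbolic_score_le1 d0.
  have mk := hyperbolic_score_measurable d0.
  split; [exact: hyperbolic_smooth|exact: p0| |].
    exact: (additive_fisher_defined p0 dp k1 mk).
  move=> b P; have s0 := hyperbolic_sign_mean0 (eps / 2) b.
  split.
  + exact: (sgn_fisher_defined p0 dp k1 mk s0).
  + have := hyperbolic_sgn_fisher_ge d0 b; apply: le_trans.
    have -> : 2 * `|eps / 2| = eps.
      by rewrite gtr0_norm ?divr_gt0// mulrC divfK.
    (* The maximum with [0] covers [1 < eps], when the lower bound is negative. *)
    apply: (@le_trans _ _ (Num.max 0 (1 - eps))); last first.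
      by rewrite ge_max expR_ge0 expR_ge1Dx.
    have F0 : 0 <= fisher P := hyperbolic_fisher_ge0 d0.
    have F1 : fisher P <= 1 := hyperbolic_fisher_le1 d0.
    have [e1|e1] := leP 0 (1 - eps).
      by rewrite ler_piMr.
    by rewrite nmulr_rle0.
  + exact: (sgn_fisher_le p0 dp k1 mk s0).
- exact: hyperbolic0E.
- exact: hyperbolic_gt0.
- exact: hyperbolic0_not_smooth.
- move=> y; apply: cvg_at_right_filter.
  have half0 : eps / 2 @[eps --> (0 : R)] --> (0 : R).
    by rewrite -[X in _ --> X](mul0r 2^-1); apply: cvgM; [exact: cvg_id|exact: cvg_cst].
  exact: (@cvg_comp _ _ _ (fun eps => eps / 2) (fun d => hyperbolic d y) _ _ _ half0
    (@hyperbolic_cvg R y)).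
Qed.
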